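(* Let $n\ge3$ and let $\{D_I\}_{I\in\binom{[n]}{2}}$ be a family of positive real numbers. For $x\in[n]$ put $t_x=\frac12\min_{y,z\in[n]\setminus\{x\},\,y\neq z}\{D_{x,y}+D_{x,z}-D_{y,z}\}$, and let $a,b\in[n]$ be such that $D_{a,b}-t_a-t_b=\max_{i,j\in[n]}\{D_{i,j}-t_i-t_j\}$. Then the family is caterpillarlike if and only if: (i) the family satisfies the four-point condition; (ii) the family is median; (iii) $D_{a,b}+D_{i,j}\ge\max\{D_{a,i}+D_{b,j},\ D_{a,j}+D_{b,i}\}$ for all distinct $i,j\in[n]\setminus\{a,b\}$.
   Context: Write $D_{i,j}=D_{\{i,j\}}$, with the convention $D_{i,i}=0$. The four-point condition: for all distinct $i,j,k,h\in[n]$, the maximum of $\{D_{i,j}+D_{k,h},D_{i,k}+D_{j,h},D_{i,h}+D_{k,j}\}$ is attained at least twice. The family is median if for any $a,b,c\in[n]$ there is a unique $m\in[n]$ such that $D_{i,j}=D_{i,m}+D_{j,m}$ for all distinct $i,j\in\{a,b,c\}$. A tree $C$ is a caterpillar if there is a path whose vertex set is exactly the set of vertices of $C$ of degree at least $2$. The family is caterpillarlike if there is a caterpillar $C$ with $V(C)=[n]$ and $w:E(C)\to\mathbb R_{>0}$ such that for all distinct $i,j$, the total weight of the path in $C$ from $i$ to $j$ equals $D_{i,j}$.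
   Formalization: In the definition of median, a, b, c are taken pairwise distinct; read literally with a=b≠c, both m=a and m=c qualify, so no family would be median and the equivalence would fail. *)

(* Defs.v *)
From mathcomp Require Import all_boot all_order all_algebra.
From mathcomp Require Import reals.
Set Implicit Arguments.
Unset Strict Implicit.
Unset Printing Implicit Defensive.
Import Order.TTheory GRing.Theory Num.Theory.
Local Open Scope ring_scope.

(* Maximum and minimum of a nonempty sequence; the value 0 on the empty
   sequence is junk. *)
Definition seq_max (R : realType) (s : seq R) : R :=
  \big[Num.max/head 0 s]_(v <- s) v.

Definition seq_min (R : realType) (s : seq R) : R :=
  \big[Num.min/head 0 s]_(v <- s) v.

(* A family {D_I} indexed by the 2-subsets of [n] is a function on all subsets
   of 'I_n; only its values on sets of cardinality 2 are ever used. *)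
Definition positive_family (R : realType) (n : nat) (D : {set 'I_n} -> R) :=
  forall I : {set 'I_n}, #|I| = 2%N -> 0 < D I.

Definition dist (R : realType) (n : nat) (D : {set 'I_n} -> R) (i j : 'I_n) : R :=
  if i == j then 0 else D [set i; j].

Definition four_point (R : realType) (n : nat) (D : {set 'I_n} -> R) :=
  let d := dist D in
  forall i j k h : 'I_n, uniq [:: i; j; k; h] ->
    let s := [:: d i j + d k h; d i k + d j h; d i h + d k j] in
    (2 <= count_mem (seq_max s) s)%N.

(* The points a, b, c are required to be distinct: for a = b <> c both m = a
   and m = c satisfy the equation, so uniqueness could never hold. *)
Definition median_family (R : realType) (n : nat) (D : {set 'I_n} -> R) :=
  let d := dist D in
  forall a b c : 'I_n, uniq [:: a; b; c] ->
    exists! m : 'I_n, forall i j : 'I_n,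
      i \in [:: a; b; c] -> j \in [:: a; b; c] -> i != j ->
      d i j = d i m + d j m.

Definition t_val (R : realType) (n : nat) (D : {set 'I_n} -> R) (x : 'I_n) : R :=
  let d := dist D in
  2^-1 * seq_min [seq d x p.1 + d x p.2 - d p.1 p.2 |
                   p : 'I_n * 'I_n in
                   [pred p | [&& p.1 != x, p.2 != x & p.1 != p.2]]].

(* The sequence x :: p lists the vertices of a (simple) path of the graph e. *)
Definition simple_path (V : finType) (e : rel V) (x : V) (p : seq V) : bool :=
  path e x p && uniq (x :: p).

(* For symmetric e the closed walk x, y, x along an edge is a ucycle, so a
   genuine cycle is a ucycle with at least 3 vertices. *)
Definition is_tree (V : finType) (e : rel V) :=
  [/\ symmetric e, irreflexive e, forall x y, connect e x y
    & forall c : seq V, ucycle e c -> (size c < 3)%N].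

Definition degree (V : finType) (e : rel V) (v : V) : nat := #|[set u | e v u]|.

Definition is_caterpillar (V : finType) (e : rel V) :=
  is_tree e /\
  exists (x : V) (p : seq V),
    simple_path e x p /\ forall v, (v \in x :: p) = (2 <= degree e v)%N.

(* An edge is identified with the 2-subset of its endpoints. *)
Definition path_weight (R : realType) (V : finType) (w : {set V} -> R)
    (x : V) (p : seq V) : R :=
  \sum_(E <- pairmap (fun u v => [set u; v]) x p) w E.

(* In a tree the simple path from i to (last i p) exists and is unique, so
   quantifying over all p ranges over exactly one path. *)
Definition caterpillarlike (R : realType) (n : nat) (D : {set 'I_n} -> R) :=
  exists (e : rel 'I_n) (w : {set 'I_n} -> R),
    [/\ is_caterpillar e,
        forall u v, e u v -> 0 < w [set u; v]
      & forall (i j : 'I_n) (p : seq 'I_n), i != j ->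
          simple_path e i p -> last i p = j -> path_weight w i p = D [set i; j]].

(* Main.v *)
Require Import Defs.
From mathcomp Require Import all_boot all_order all_algebra.
From mathcomp Require Import reals.
From mathcomp Require Import lra.
Set Implicit Arguments.
Unset Strict Implicit.
Unset Printing Implicit Defensive.
Import Order.TTheory GRing.Theory Num.Theory.
Local Open Scope ring_scope.

(** A tree metric on the vertex set of a caterpillar is a "line with pendants":
    d i j = |s i - s j| + t i + t j for distinct i, j, where s is the position
    along the spine of the foot of i and t i the length of the pendant edge at
    i.  In a caterpillar this t is t_val; the four-point condition, the median
    property and (iii) then reduce to the order of points on a line.

    Conversely, join u and v when no third point lies between them.  A median
    of u, v, w with u--v--w must be v, so locally injective walks are locally
    geodesic, and the four-point condition makes them geodesic; hence the graph
    is a tree inducing D.  Condition (iii) forces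
    d a i + d b i - d a b = 2 t i, that is, every foot lies between a and b,
    which yields the coordinate s i = d a i - t a - t i; the vertices with
    t = 0, sorted by s, form the spine.  If a = b, (iii) says that D is a star
    centered at a. *)

(** * Extrema of finite sequences *)

Section Extrema.

Variable R : realType.
Implicit Types (s : seq R) (v x y z : R).

Lemma seq_min_le s v : v \in s -> seq_min s <= v.
Proof.
rewrite /seq_min; move: (head 0 s) => h.
elim: s => //= u s IHs; rewrite inE big_cons => /predU1P[->|/IHs le_sv].
  by rewrite ge_min lexx.
by rewrite ge_min le_sv orbT.
Qed.

Lemma seq_min_mem s : s != [::] -> seq_min s \in s.
Proof.
case: s => // h s _; rewrite /seq_min /= big_cons.
suff: \big[Num.min/h]_(v <- s) v \in h :: s.
  by rewrite minEle; case: ifP => // _; rewrite mem_head.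
elim: s => [|u s IHs]; first by rewrite big_nil mem_head.
rewrite big_cons minEle; case: ifP => _; first by rewrite !inE eqxx orbT.
by move: IHs; rewrite !inE => /orP[->|->] //; rewrite !orbT.
Qed.

Lemma seq_max_ge s v : v \in s -> v <= seq_max s.
Proof.
rewrite /seq_max; move: (head 0 s) => h.
elim: s => //= u s IHs; rewrite inE big_cons => /predU1P[->|/IHs le_vs].
  by rewrite le_max lexx.
by rewrite le_max le_vs orbT.
Qed.

Lemma seq_max_mem s : s != [::] -> seq_max s \in s.
Proof.
case: s => // h s _; rewrite /seq_max /= big_cons.
suff: \big[Num.max/h]_(v <- s) v \in h :: s.
  by rewrite maxEle; case: ifP => // _; rewrite mem_head.
elim: s => [|u s IHs]; first by rewrite big_nil mem_head.
rewrite big_cons maxEle; case: ifP => _; last by rewrite !inE eqxx orbT.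
by move: IHs; rewrite !inE => /orP[->|->] //; rewrite !orbT.
Qed.

(** A maximum attained only once is an entry strictly above both others; each conjunct excludes this
    for one entry. *)
Lemma count_seq_max3 x y z :
  (2 <= count_mem (seq_max [:: x; y; z]) [:: x; y; z])%N =
  [&& (x <= y) || (x <= z), (y <= x) || (y <= z) & (z <= x) || (z <= y)].
Proof.
have ge v := @seq_max_ge [:: x; y; z] v.
have /= := ge x; have /= := ge y; have /= := ge z.
have := @seq_max_mem [:: x; y; z] isT.
move: (seq_max _) => M; rewrite !inE !eqxx ?orbT.
move=> M3 /(_ isT) zM /(_ isT) yM /(_ isT) xM.
case/or3P: M3 zM yM xM => /eqP -> zM yM xM;
  rewrite eqxx ?(eq_le, xM, yM, zM, orbT, andbT) /=.
all: by do ![case: (_ <= _)].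
Qed.

End Extrema.

(** * Distances, the four-point condition and [t_val] *)

Section Families.

Variables (R : realType) (n : nat) (D : {set 'I_n} -> R).
Hypothesis D_gt0 : positive_family D.
Implicit Types (i j k h x y z m u v : 'I_n).

Local Notation d := (dist D).
Local Notation t := (t_val D).

Lemma distxx x : d x x = 0. Proof. by rewrite /dist eqxx. Qed.

Lemma distE x y : x != y -> d x y = D [set x; y].
Proof. by rewrite /dist => /negbTE ->. Qed.

Lemma distC x y : d x y = d y x.
Proof. by rewrite /dist eq_sym setUC. Qed.

Lemma dist_gt0 x y : x != y -> 0 < d x y.
Proof. by move=> xy; rewrite distE // D_gt0 // cards2 xy. Qed.

Lemma dist_ge0 x y : 0 <= d x y.
Proof. by case: (eqVneq x y) => [->|/dist_gt0/ltW //]; rewrite distxx. Qed.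

Lemma dist_le0_eq x y : d x y <= 0 -> x = y.
Proof. by case: (eqVneq x y) => // /dist_gt0; rewrite ltNge => /negP. Qed.

(** As all labellings are quantified over, one of the three inequalities suffices: relabelling
    yields the other two. *)
Lemma four_pointP :
  four_point D <->
  forall i j k h, uniq [:: i; j; k; h] ->
    (d i j + d k h <= d i k + d j h) || (d i j + d k h <= d i h + d j k).
Proof.
rewrite /four_point; cbv zeta.
split=> fp i j k h ijkh.
  have: (2 <= count_mem _ _)%N := fp i j k h ijkh.
  by rewrite count_seq_max3 => /and3P[+ _ _]; rewrite (distC k j).
rewrite count_seq_max3.
have: uniq [:: i; k; j; h] && uniq [:: i; h; k; j].
  move: ijkh; rewrite /= !inE.
  rewrite (eq_sym k j) (eq_sym h j) (eq_sym h k).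
  by do ![case: (_ == _)].
case/andP => /fp ikjh /fp ihkj; move/fp: ijkh.
rewrite (distC k j) (distC h j) (distC h k) in ikjh ihkj *.
by move=> ->; rewrite ikjh orbC ihkj.
Qed.

Lemma t_val_le x y z : y != x -> z != x -> y != z ->
  t x + t x <= d x y + d x z - d y z.
Proof.
move=> yx zx yz; rewrite /t_val.
set s := [seq _ | _ in _].
have: d x y + d x z - d y z \in s.
  by apply/imageP; exists (y, z) => //; rewrite inE yx zx.
by move/seq_min_le => /= ?; lra.
Qed.

(* [s i] is the position of the foot of [i] on the spine and [r i] the length of
   the pendant edge at [i]; the last clause says that every foot is a vertex. *)
Definition linear_coords (s r : 'I_n -> R) :=
  [/\ forall i j, i != j -> d i j = `|s i - s j| + r i + r j,
      forall i, 0 <= r i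
    & forall i, exists v, r v = 0 /\ s v = s i].

Section AtLeastThree.

Hypothesis n_ge3 : (3 <= n)%N.

Lemma third_point x y : exists z, (z != x) && (z != y).
Proof.
have: (0 < #|~: [set x; y]|)%N.
  rewrite cardsCs setCK card_ord subn_gt0 (leq_ltn_trans _ n_ge3) //.
  by rewrite cards2; case: (_ != _).
by case/card_gt0P => z; rewrite !inE negb_or; exists z.
Qed.

(** Since n >= 3 the list of values is nonempty, so its minimum is attained and the junk value of
    [seq_min] is avoided. *)
Lemma t_val_witness x : exists y z,
  [/\ y != x, z != x, y != z & t x + t x = d x y + d x z - d y z].
Proof.
have [y /andP[yx _]] := third_point x x.
have [z /andP[zx zy]] := third_point x y.
rewrite /t_val; set s := [seq _ | _ in _].
have s0: s != [::].
  apply: contraTneq (ltn0Sn 0) => s0; have: d x y + d x z - d y z \in s.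
    by apply/imageP; exists (y, z) => //; rewrite inE yx zx eq_sym.
  by rewrite s0.
have /imageP[[y' z'] + ->] := seq_min_mem s0.
rewrite inE => /and3P[/= y'x z'x y'z']; exists y', z'; split=> //; lra.
Qed.

End AtLeastThree.

(** * Sufficiency: the tree built from the four-point condition and medians *)

Section FourPointMedian.

Hypothesis n_ge3 : (3 <= n)%N.
Hypothesis D4 : forall i j k h, uniq [:: i; j; k; h] ->
  (d i j + d k h <= d i k + d j h) || (d i j + d k h <= d i h + d j k).
Hypothesis Dmed : median_family D.

Lemma median_exists x y z : x != y -> x != z -> y != z ->
  exists m, [/\ d x y = d x m + d y m, d x z = d x m + d z m
              & d y z = d y m + d z m].
Proof.
move=> xy xz yz.
have xyz: uniq [:: x; y; z] by rewrite /= !inE negb_or xy xz yz.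
have [m [/= mP _]] := Dmed xyz.
by exists m; split; apply: mP => //; rewrite !inE eqxx ?orbT.
Qed.

(** If m is the median of x, y, z, the defect of the inequality is twice [d y m]. *)
Lemma dist_tri y x z : d x z <= d x y + d y z.
Proof.
have [->|xy] := eqVneq x y; first by rewrite distxx add0r.
have [<-|yz] := eqVneq y z; first by rewrite distxx addr0.
have [<-|xz] := eqVneq x z; first by rewrite distxx addr_ge0 // dist_ge0.
have [m [-> -> ->]] := median_exists xy xz yz.
have := dist_ge0 y m; lra.
Qed.

(** Quadruples with repetitions reduce to the triangle inequality or to an identity. *)
Lemma four_point_weak i j k h :
  (d i j + d k h <= d i k + d j h) || (d i j + d k h <= d i h + d j k).
Proof.
apply/orP.
have [->|ij] := eqVneq i j.
  by left; rewrite distxx add0r (distC j k) dist_tri.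
have [->|kh] := eqVneq k h.
  by left; rewrite distxx addr0 (distC j h) dist_tri.
have [->|ik] := eqVneq i k; first by right; rewrite (distC j k); lra.
have [->|ih] := eqVneq i h; first by left; rewrite (distC h k) (distC j h); lra.
have [->|jk] := eqVneq j k; first by left; lra.
have [->|jh] := eqVneq j h; first by right; rewrite (distC h k).
by apply/orP/D4; rewrite /= !inE !negb_or ij ik ih jk jh kh.
Qed.

Lemma t_ge0 x : 0 <= t x.
Proof.
have [y [z [_ _ _ tE]]] := t_val_witness n_ge3 x.
have := dist_tri x y z; rewrite (distC y x); lra.
Qed.

Definition adj : rel 'I_n := fun u v =>
  (u != v) && [forall w, (d u v == d u w + d w v) ==> (w \in [:: u; v])].

Lemma adjP u v w : adj u v -> d u v = d u w + d w v -> w = u \/ w = v.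
Proof.
case/andP=> _ /forallP/(_ w)/implyP adjuv /eqP/adjuv.
by rewrite !inE => /orP[]/eqP; [left|right].
Qed.

Lemma adj_neq u v : adj u v -> u != v.
Proof. by case/andP. Qed.

Lemma adj_sym : symmetric adj.
Proof.
move=> u v; rewrite /adj eq_sym; congr andb; apply: eq_forallb => w.
by rewrite (distC v u) (distC u w) (distC w v) addrC !inE orbC.
Qed.

Lemma adj_irr : irreflexive adj.
Proof. by move=> u; rewrite /adj eqxx. Qed.

(** The median lies between the ends of both edges, so it is an end of both, namely v. *)
Lemma adj_adj_dist u v w : adj u v -> adj v w -> u != w ->
  d u w = d u v + d v w.
Proof.
move=> uv vw uw; have [m [duv duw dvw]] :=
  median_exists (adj_neq uv) uw (adj_neq vw).
rewrite (distC v m) in duv; rewrite (distC w m) in dvw duw.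
have /(adjP uv)[mu|mv] := duv; last by subst m.
have /(adjP vw)[mE|mE] := dvw; rewrite mu in mE.
  by rewrite mE distxx add0r.
by rewrite mE eqxx in uw.
Qed.

(* The last point l enters only through the four-point condition on u, v, w, l:
   u--v--w and v--w--l are geodesic and v <> w, hence so is u--v--l. *)
Lemma adj_path_dist_cons u v q : path adj u (v :: q) -> uniq (u :: v :: q) ->
  d u (last v q) = d u v + d v (last v q).
Proof.
elim: q u v => [|w q IHq] u v; first by rewrite /= distxx addr0.
case/andP=> uv vwq /andP[uvwq Uvwq]; rewrite [last v _]/=.
have:= IHq v w vwq Uvwq; have vw: adj v w by case/andP: vwq.
have uw: u != w by move: uvwq; rewrite !inE !negb_or => /and3P[].
have:= adj_adj_dist uv vw uw; have:= dist_gt0 (adj_neq vw).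
move: (last w q) => l; have := dist_tri v u l.
have := four_point_weak u w v l; rewrite (distC w v).
by case/orP; lra.
Qed.

Lemma adj_path_weight u p : simple_path adj u p ->
  path_weight D u p = d u (last u p).
Proof.
rewrite /path_weight; elim: p u => [|v q IHq] u /andP[up Uup].
  by rewrite big_nil distxx.
have /andP[uv vq] := up; have /andP[_ Uvq] := Uup.
rewrite [LHS]big_cons IHq; last by apply/andP.
by rewrite [last u _]/= (adj_path_dist_cons up Uup) (distE (adj_neq uv)).
Qed.

Definition between u v : {set 'I_n} := [set x | d u v == d u x + d x v].

Lemma betweenC u v : between u v = between v u.
Proof.
by apply/setP=> x; rewrite !inE addrC (distC u v) (distC u x) (distC x v).
Qed.

Lemma card_between_lt x y z : d x z = d x y + d y z -> y != z ->
  (#|between x y| < #|between x z|)%N.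
Proof.
move=> dxz yz; apply/proper_card/properP; split.
  apply/subsetP=> m; rewrite !inE => /eqP dxy; apply/eqP.
  have := dist_tri m x z; have := dist_tri y m z; lra.
exists z; rewrite !inE ?distxx ?addr0 //.
apply/eqP; have := dist_gt0 yz; rewrite (distC z y); lra.
Qed.

Lemma adj_connect u v : connect adj u v.
Proof.
have [k] := ubnP #|between u v|.
elim: k u v => // k IHk u v; rewrite ltnS => le_k.
have [<-|uv] := eqVneq u v; first exact: connect0.
case: (boolP (adj u v)) => [/connect1 // |].
rewrite negb_and uv /= => /forallPn[w]; rewrite negb_imply !inE negb_or.
case/and3P=> /eqP duv wu wv.
apply: (@connect_trans _ _ w); apply: IHk; apply: leq_trans le_k.
  exact: card_between_lt.
rewrite betweenC (betweenC u) card_between_lt //.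
by rewrite (distC v u) (distC v w) (distC w u) addrC.
Qed.

(** Deleting the closing edge of a cycle leaves a geodesic path, so its second vertex lies between
    the ends of that edge, which are adjacent. *)
Lemma adj_tree : is_tree adj.
Proof.
split; [exact: adj_sym | exact: adj_irr | exact: adj_connect | ].
case=> [|x [|y [|z q]]] // /andP[]; rewrite [cycle _ _]/= rcons_path.
rewrite [last _ _]/= => /and4P[xy yz zq lx] U.
have:= adj_path_dist_cons (_ : path adj x [:: y, z & q]) U.
rewrite /= xy yz zq => /(_ isT); rewrite [LHS]distC [RHS]addrC.
rewrite (distC y (last _ _)) (distC x y) => /(adjP lx)[] yE; move: U.
  by rewrite /= yE mem_last andbF.
by rewrite yE /= inE eqxx.
Qed.

Lemma adj_first_step v y : v != y ->
  exists2 u, adj v u & d v y = d v u + d u y.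
Proof.
move=> vy; have /connectP[p0 vp0 yE] := adj_connect v y.
move: yE; case/shortenP: vp0 => [[|u p] vp U _] yE.
  by rewrite yE eqxx in vy.
exists u; first by case/andP: vp.
by rewrite yE /=; apply: adj_path_dist_cons.
Qed.

(** Two neighbours of v have v between them, whence t v = 0. Conversely, if v lies between y and z,
    the first steps from v towards y and z differ. *)
Lemma degree_adj_gt1 v : (2 <= degree adj v)%N = (t v == 0).
Proof.
apply/card_gt1P/eqP => [[u [w [+ + uw]]]|tv0].
  rewrite !inE => vu vw; have uv: adj u v by rewrite adj_sym.
  have := t_ge0 v; have := adj_adj_dist uv vw uw.
  have := t_val_le (_ : u != v) (_ : w != v) uw.
  rewrite (eq_sym w) !adj_neq // (distC v u) => /(_ isT isT); lra.
have [y [z [yv zv yz]]] := t_val_witness n_ge3 v; rewrite tv0 => yvz.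
have [|u vu dvu] := @adj_first_step v y; first by rewrite eq_sym.
have [|w vw dvw] := @adj_first_step v z; first by rewrite eq_sym.
exists u, w; rewrite !inE; split=> //; apply/eqP => uw; subst w.
have := dist_gt0 (adj_neq vu); have := dist_tri u y z.
rewrite (distC y u); lra.
Qed.

(** Take for q the median of i and a pair y, z realizing [t i]. If q differs from i, it lies
    strictly between i and one of y, z, so t q = 0. *)
Lemma t_parent i : exists q, t q = 0 /\ d i q = t i.
Proof.
have [y [z [yi zi yz tiE]]] := t_val_witness n_ge3 i.
have iy: i != y by rewrite eq_sym.
have iz: i != z by rewrite eq_sym.
have [q [diy diz dyz]] := median_exists iy iz yz.
have diq: d i q = t i by lra.
exists q; split=> //; have [qi|qi] := eqVneq q i.
  by rewrite qi distxx in diq *.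
suff: exists2 u, u != q & u != i /\ d i u = d i q + d u q.
  case=> u uq [ui diu]; have := t_val_le (_ : i != q) uq (_ : i != u).
  rewrite eq_sym qi eq_sym ui (distC q i) (distC q u) => /(_ isT isT).
  have := t_ge0 q; lra.
have [yq|yq] := eqVneq y q; last by exists y.
by exists z; rewrite // -yq eq_sym.
Qed.

(** Adding the bounds on [t i] and [t j] given by a common third point z cancels the distances to
    z. *)
Lemma t_add_le i j : i != j -> t i + t j <= d i j.
Proof.
move=> ij; have [z /andP[zi zj]] := third_point n_ge3 i j.
have := t_val_le (_ : j != i) zi (_ : j != z).
have := t_val_le ij zj (_ : i != z).
rewrite (eq_sym j i) ij ![_ == z]eq_sym zi zj.
move=> /(_ isT) + /(_ isT isT); rewrite (distC j i); lra.
Qed.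

(* The last hypothesis lets the induction forget the spine vertices already
   passed. *)
Lemma spine_path s x q : linear_coords s t ->
    (forall y, y \in x :: q -> t y = 0) ->
    pairwise (fun u v => s u <= s v) (x :: q) -> uniq (x :: q) ->
    (forall w, t w = 0 -> w \in x :: q \/ s w <= s x) ->
  path adj x q.
Proof.
move=> [dE _ _]; elim: q x => // y q IHq x t0.
case/andP=> /allP le_x pw_q /andP[x_q Uq] spine.
have le_xy: s x <= s y := le_x y (mem_head _ _).
have xy: x != y by move: x_q; rewrite inE negb_or => /andP[].
have tx: t x = 0 by rewrite t0 ?mem_head.
have ty: t y = 0 by rewrite t0 // inE mem_head orbT.
have /andP[/allP le_y _] := pw_q.
apply/andP; split.
  rewrite /adj xy; apply/forallP=> w; apply/implyP=> /eqP.
  rewrite !inE; case: eqVneq => //= wx; case: eqVneq => //= wy.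
  have := dist_gt0 wy; have := dist_gt0 wx; rewrite (distC w x).
  rewrite !dE // 1?eq_sym // tx ty => xw_gt0 wy_gt0 wE.
  (* A third point between x and y would be a spine vertex with coordinate strictly in between,
     against the sorting. *)
  have [tw lt_xw lt_wy]: [/\ t w = 0, s x < s w & s w < s y].
    have tw_ge0 := t_ge0 w; move: xw_gt0 wy_gt0 wE.
    case: (ger0P (s x - s w)) => ?; case: (ger0P (s w - s y)) => ?;
      case: (ger0P (s x - s y)) => ? ? ? ?; split; lra.
  have [|] := spine w tw; last by rewrite leNgt lt_xw.
  rewrite !inE (negbTE wx) (negbTE wy) /= => /le_y.
  by rewrite leNgt lt_wy.
apply: IHq => // [z zq|w /spine[]]; first by rewrite t0 // inE zq orbT.
  by rewrite inE => /predU1P[->|]; [right|left].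
by move=> le_wx; right; apply: le_trans le_wx le_xy.
Qed.

Lemma linear_caterpillarlike s : linear_coords s t -> caterpillarlike D.
Proof.
move=> st; exists adj, D; split.
- split; first exact: adj_tree.
  pose leS u v := s u <= s v.
  have memS v : (v \in sort leS (enum [pred v | t v == 0])) = (t v == 0).
    by rewrite mem_sort mem_enum.
  have: pairwise leS (sort leS (enum [pred v | t v == 0])).
    rewrite -sorted_pairwise ?sort_sorted //.
      by move=> u v; apply: le_total.
    by move=> v u w; apply: le_trans.
  have: uniq (sort leS (enum [pred v | t v == 0])).
    by rewrite sort_uniq enum_uniq.
  case: (sort _ _) memS => [|x q] memS Uq pwq.
    (* The spine is nonempty: it contains the foot of vertex 0. *)
    have [_ _ /(_ (Ordinal (ltnW (ltnW n_ge3))))[v [tv _]]] := st.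
    by move: (memS v); rewrite tv eqxx.
  exists x, q; split=> [|v]; last by rewrite memS degree_adj_gt1.
  rewrite /simple_path Uq andbT; apply: (spine_path st) => // [y|w tw].
    by rewrite memS => /eqP.
  by left; rewrite memS tw.
- by move=> u v /adj_neq uv; rewrite -distE // dist_gt0.
- by move=> i j p ij ip pj; rewrite adj_path_weight // pj distE.
Qed.

(** * Coordinates along the spine from condition (iii) *)

Section ReferencePair.

Variables a b : 'I_n.
Hypothesis Dab : forall i j,
  i \notin [:: a; b] -> j \notin [:: a; b] -> i != j ->
  d a i + d b j <= d a b + d i j.

(* The converse inequality holds by definition of [t]: (iii) forces the foot of
   [i] to lie between [a] and [b].  The proof applies it to [i] and the parent
   [q] of [i]; if [q = i], to [i] and a point which [i] separates from [a]. *)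
Lemma product_ab_le i : i \notin [:: a; b] ->
  d a i + d b i <= d a b + t i + t i.
Proof.
move=> iab; have [q [tq dq]] := t_parent i; have [qi|qi] := eqVneq q i.
  have ti0: t i = 0 by rewrite -dq qi distxx.
  have [y [z [yi zi yz]]] := t_val_witness n_ge3 i; rewrite ti0 !addr0 => dyz.
  suff far u : u != i -> d a i + d i u <= d a u -> d a i + d b i <= d a b.
    (* As i lies between y and z, the four-point condition puts i between a and one of them. *)
    have := four_point_weak y z i a; rewrite !(distC _ a).
    rewrite (distC z i) (distC y i).
    have := far _ yi; have := far _ zi; move=> fz fy /orP[le|le].
      apply: fz; lra.
    apply: fy; lra.
  move=> ui dau; case: (boolP (u \in [:: a; b])) => [|uab].
    rewrite !inE => /orP[]/eqP uE; subst u.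
      have := dist_gt0 ui; have := dist_ge0 i a; rewrite distxx in dau; lra.
    by rewrite (distC b i).
  have := Dab uab iab ui; rewrite (distC u i); lra.
case: (boolP (q \in [:: a; b])) => [|qab].
  rewrite !inE => /orP[]/eqP qE; subst q.
    have := dist_tri a b i; rewrite (distC a i) (distC b a); lra.
  have := dist_tri b a i; rewrite (distC b i); lra.
have := Dab iab qab; have := Dab qab iab qi; have := dist_tri q a b.
rewrite (distC q i) (distC q b) eq_sym qi => ? ? /(_ isT); lra.
Qed.

(** For a = b, (iii) and the triangle inequality put a between any two points; hence t i = [d a i]
    and a is the only foot. *)
Lemma star_coords : a = b -> linear_coords (fun=> 0) t.
Proof.
move=> ab; subst b.
have dE i j : i != j -> d i j = d a i + d a j.
  move=> ij; have [ia|ia] := eqVneq i a; first by rewrite ia distxx add0r.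
  have [ja|ja] := eqVneq j a; first by rewrite ja distxx addr0 distC.
  have := Dab _ _ ij; rewrite !inE !orbb ia ja distxx => /(_ isT isT).
  have := dist_tri a i j; rewrite (distC i a); lra.
have tE i : t i = d a i.
  have [y [z [yi zi yz tiE]]] := t_val_witness n_ge3 i.
  have: t i + t i <= d a i + d a i.
    have [ia|ia] := eqVneq i a.
      by subst i; have := t_val_le yi zi yz; rewrite distxx (dE _ _ yz); lra.
    have [u /andP[ui ua]] := third_point n_ge3 i a.
    have := t_val_le (_ : a != i) ui (_ : a != u).
    rewrite ![a == _]eq_sym ia ua (dE i u) 1?eq_sym // => /(_ isT isT).
    by rewrite (distC i a); lra.
  have := dist_tri a y z; rewrite (distC y a).
  rewrite !(dE i) 1?eq_sym // in tiE; lra.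
split=> [i j ij|i|i]; first by rewrite dE // !tE subrr normr0 add0r.
  exact: t_ge0.
by exists a; rewrite tE distxx.
Qed.

(** The point a is treated apart because the general formula would give it the coordinate -2 [t a]
    instead of 0. *)
Lemma segment_coords : a != b ->
  linear_coords (fun i => if i == a then 0 else d a i - t a - t i) t.
Proof.
move=> ab; set s := fun i => _.
have sa: s a = 0 by rewrite /s eqxx.
have s_ge0 i : 0 <= s i.
  rewrite /s; case: eqVneq => // ia.
  have := t_add_le ia; rewrite (distC i a); lra.
have da i : i != a -> d a i = s i + t a + t i.
  by rewrite /s => /negbTE ->; lra.
have ba : b != a by rewrite eq_sym.
have db i : i != b -> d b i = (s b - s i) + t b + t i.
  move=> ib; have [->|ia] := eqVneq i a; first by rewrite sa distC da //; lra.
  have iab : i \notin [:: a; b] by rewrite !inE negb_or ia.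
  have := product_ab_le iab; have := t_val_le (_ : a != i) (_ : b != i) ab.
  rewrite ![_ == i]eq_sym ia ib !da // ![d i _]distC da // => /(_ isT isT).
  lra.
have s_le i : s i <= s b.
  have [->//|ib] := eqVneq i b.
  have := t_add_le ib; rewrite distC db //; lra.
have dE i j : i != j -> d i j = `|s i - s j| + t i + t j.
  move=> ij; have [ia|ia] := eqVneq i a.
    by rewrite ia sa sub0r normrN ger0_norm // da // -ia eq_sym.
  have [ja|ja] := eqVneq j a.
    by rewrite ja sa subr0 ger0_norm // distC da //; lra.
  have [ib|ib] := eqVneq i b.
    by rewrite ib ger0_norm ?subr_ge0 // db // -ib eq_sym.
  have [jb|jb] := eqVneq j b.
    by rewrite jb distrC ger0_norm ?subr_ge0 // distC db //; lra.
  have iab : i \notin [:: a; b] by rewrite !inE negb_or ia.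
  have jab : j \notin [:: a; b] by rewrite !inE negb_or ja.
  (* With the four-point condition, (iii) makes [d a b + d i j] the larger of the two mixed sums,
     which exceed [d a b] by [t i + t j] plus or minus [s i - s j]. *)
  have := Dab iab jab ij; have := Dab jab iab; rewrite eq_sym => /(_ ij).
  rewrite (distC j i); have := four_point_weak a b i j.
  rewrite !da // !db //; case: ger0P => ? /orP[]; lra.
split=> // [i|i]; first exact: t_ge0.
have [q [tq dq]] := t_parent i; exists q; split=> //.
have [->//|qi] := eqVneq q i.
rewrite dE 1?eq_sym // tq in dq.
have: `|s i - s q| <= 0 by lra.
by rewrite normr_le0 subr_eq0 => /eqP.
Qed.

End ReferencePair.

End FourPointMedian.

(** * Necessity: linear coordinates imply (i), (ii) and (iii) *)

Section LinearCoordinates.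

Variables s r : 'I_n -> R.
Hypothesis sr : linear_coords s r.

Let dE i j : i != j -> d i j = `|s i - s j| + r i + r j.
Proof. by case: sr => + _ _; apply. Qed.

Let r_ge0 i : 0 <= r i.
Proof. by case: sr => _ + _; apply. Qed.

Lemma linear_dist_spine i v : r v = 0 -> d i v = `|s i - s v| + r i.
Proof.
move=> rv; have [->|iv] := eqVneq i v.
  by rewrite distxx subrr normr0 rv addr0.
by rewrite dE // rv addr0.
Qed.

Lemma linear_tri x y z : x != y -> x != z -> y != z ->
  r x + r x <= d x y + d x z - d y z.
Proof.
move=> xy xz yz; rewrite !dE // (distrC (s x) (s y)).
have := ler_distD (s x) (s y) (s z); lra.
Qed.

(** The pendant lengths add the same amount to all three sums, which leaves four points on a
    line. *)
Lemma linear_four_point : four_point D.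
Proof.
apply/four_pointP => i j k h; rewrite /= !inE !negb_or.
case/and4P=> /and3P[ij ik ih] /andP[jk jh] kh _; rewrite !dE //.
move: (s i) (s j) (s k) (s h) => si sj sk sh; apply/orP.
case: (ger0P (si - sj)) => ?; case: (ger0P (sk - sh)) => ?;
case: (ger0P (si - sk)) => ?; case: (ger0P (sj - sh)) => ?;
case: (ger0P (si - sh)) => ?; case: (ger0P (sj - sk)) => ?;
try (by left; lra); right; lra.
Qed.

(* The set [{x, y, z}] is given by any of its enumerations [S], so that the
   middle point may be assumed to be [y]. *)
Lemma linear_median_between x y z (S : seq 'I_n) :
    uniq [:: x; y; z] -> S =i [:: x; y; z] ->
    `|s x - s z| = `|s x - s y| + `|s y - s z| ->
  exists! m, forall i j, i \in S -> j \in S -> i != j -> d i j = d i m + d j m.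
Proof.
rewrite /= !inE negb_or => /and3P[/andP[xy xz] yz _] SE xyz.
(* The median is the foot of the middle point y. *)
have [_ _ /(_ y)[m [rm sm]]] := sr.
exists m; split=> [i j|m' m'P].
  rewrite !SE !inE => /or3P[]/eqP-> /or3P[]/eqP->; rewrite ?eqxx // => ij;
  rewrite dE // !linear_dist_spine // sm ?subrr ?normr0
    ?(distrC (s y) (s x)) ?(distrC (s z) (s x)) ?(distrC (s z) (s y)); lra.
have mem u : u \in [:: x; y; z] -> u \in S by rewrite SE.
have := m'P y z; have := m'P x z; have := m'P x y.
rewrite !mem ?inE ?eqxx ?orbT //.
move=> /(_ isT isT xy) + /(_ isT isT xz) + /(_ isT isT yz).
rewrite (dE xy) (dE xz) (dE yz) => xym xzm yzm.
(* Either m' = y and r y = 0, or m' has no pendant length and shares the coordinate of y; both give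
   m' = m. *)
have ym': d y m' = r y by lra.
have [m'y|m'y] := eqVneq m' y.
  apply: dist_le0_eq; rewrite distC linear_dist_spine // sm m'y subrr normr0.
  by rewrite -ym' m'y distxx addr0.
rewrite dE 1?eq_sym // in ym'.
apply: dist_le0_eq; rewrite distC linear_dist_spine // sm distrC.
have := r_ge0 m'; have := normr_ge0 (s y - s m'); lra.
Qed.

Lemma linear_median : median_family D.
Proof.
move=> x y z xyz.
have [xyzE|[xzyE|yxzE]] : `|s x - s z| = `|s x - s y| + `|s y - s z| \/
    (`|s x - s y| = `|s x - s z| + `|s z - s y| \/
     `|s y - s z| = `|s y - s x| + `|s x - s z|).
- move: (s x) (s y) (s z) => sx sy sz; rewrite (distrC sz) (distrC sy sx).
  case: (ger0P (sx - sy)) => ?; case: (ger0P (sx - sz)) => ?;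
  case: (ger0P (sy - sz)) => ?;
  try (by left; lra); right; try (by left; lra); right; lra.
- exact: linear_median_between xyzE.
- apply: linear_median_between xzyE => [|u].
    move: xyz; rewrite /= !inE !negb_or (eq_sym z y).
    by case/and3P=> /andP[-> ->] ->.
  by rewrite !inE (orbC (u == y)).
- apply: linear_median_between yxzE => [|u].
    move: xyz; rewrite /= !inE !negb_or (eq_sym y x).
    by case/and3P=> /andP[-> ->] ->.
  by rewrite !inE orbCA.
Qed.

(** For distinct u, v the maximized quantity is the distance between their feet, so if a and b
    differ, every foot lies between theirs. *)
Lemma linear_maximal_pair a b i j :
    (forall u v, d u v - r u - r v <= d a b - r a - r b) ->
    i \notin [:: a; b] -> j \notin [:: a; b] -> i != j ->
  d a i + d b j <= d a b + d i j.
Proof.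
move=> max_ab; rewrite !inE !negb_or => /andP[ia ib] /andP[ja jb] ij.
have := max_ab a i; have := max_ab b i; have := max_ab a j; have := max_ab b j.
rewrite ![_ == a]eq_sym ![_ == b]eq_sym in ia ib ja jb.
have [ab|ab] := eqVneq a b.
  (* Here the maximum is -2 [r a], which forces r a = 0 and all feet to coincide. *)
  subst b; rewrite !distxx !dE //.
  have := normr_ge0 (s i - s j); have := normr_ge0 (s a - s i).
  have := normr_ge0 (s a - s j); have := r_ge0 a; lra.
rewrite !dE // => baj bbi bai bbj.
have /ler_normlP[aj1 aj2]: `|s a - s j| <= `|s a - s b| by lra.
have /ler_normlP[bi1 bi2]: `|s b - s i| <= `|s a - s b| by lra.
have := ler_norm (s i - s j); have := ler_norm (s j - s i).
rewrite (distrC (s j)); move: aj1 aj2 bi1 bi2 bai bbj {baj bbi}.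
case: (ger0P (s a - s b)) => ?; case: (ger0P (s a - s i)) => ?;
case: (ger0P (s b - s j)) => ?; lra.
Qed.

End LinearCoordinates.

Lemma t_val_eq r x : (3 <= n)%N ->
    (forall y z, x != y -> x != z -> y != z ->
      r + r <= d x y + d x z - d y z) ->
    (exists y z, [/\ x != y, x != z, y != z & r + r = d x y + d x z - d y z]) ->
  t x = r.
Proof.
move=> n_ge3 r_le [y [z [xy xz yz rE]]].
have [y' [z' [y'x z'x y'z' tE]]] := t_val_witness n_ge3 x.
have := r_le y' z'; rewrite ![x == _]eq_sym y'x z'x y'z' => /(_ isT isT isT).
have := t_val_le (_ : y != x) (_ : z != x) yz.
rewrite ![_ == x]eq_sym xy xz => /(_ isT isT); lra.
Qed.

(** * Necessity: linear coordinates of a caterpillar *)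

Section CaterpillarTree.

Hypothesis n_ge3 : (3 <= n)%N.
Variables (e : rel 'I_n) (w : {set 'I_n} -> R) (x0 : 'I_n) (p0 : seq 'I_n).
Hypotheses (e_sym : symmetric e) (e_irr : irreflexive e).
Hypothesis e_conn : forall x y, connect e x y.
Hypothesis spine_simple : simple_path e x0 p0.
Hypothesis spineE : forall v, (v \in x0 :: p0) = (2 <= degree e v)%N.
Hypothesis wE : forall i j p, i != j ->
  simple_path e i p -> last i p = j -> path_weight w i p = D [set i; j].

Lemma simple_path_weight x p :
  simple_path e x p -> path_weight w x p = d x (last x p).
Proof.
move=> xp; have [xl|xl] := eqVneq x (last x p).
  rewrite -xl distxx; case: p xl xp => [|y p] /= xl.
    by rewrite /path_weight big_nil.
  by case/and3P=> _; rewrite [X in X \notin _]xl mem_last.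
by rewrite distE // (wE xl).
Qed.

Lemma simple_path_cat x p q : simple_path e x (p ++ q) ->
  simple_path e x p /\ simple_path e (last x p) q.
Proof.
rewrite /simple_path cat_path -cat_cons cat_uniq.
case/andP=> /andP[-> ->] /and3P[-> disj Uq]; split=> //=.
rewrite Uq andbT; apply: contra disj => lq.
by apply/hasP; exists (last x p); rewrite ?mem_last.
Qed.

Lemma simple_path_dist_cat x p q : simple_path e x (p ++ q) ->
  d x (last x (p ++ q)) = d x (last x p) + d (last x p) (last x (p ++ q)).
Proof.
move=> xpq; have [xp pq] := simple_path_cat xpq.
rewrite -simple_path_weight // last_cat -(simple_path_weight xp).
by rewrite -(simple_path_weight pq) /path_weight pairmap_cat big_cat.
Qed.

Lemma simple_path_exists x y : exists2 p, simple_path e x p & last x p = y.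
Proof.
have /connectP[p xp ->] := e_conn x y.
by case/shortenP: xp => q xq Uq _; exists q; rewrite // /simple_path xq.
Qed.

(** Of two spine vertices, the first one met lies on the path from [x0] to the other, so the
    distance from [x0] is a coordinate. *)
Lemma spine_dist u v : u \in x0 :: p0 -> v \in x0 :: p0 ->
  d u v = `|d x0 u - d x0 v|.
Proof.
have geod p q z : simple_path e x0 (p ++ q) -> z = last x0 (p ++ q) ->
    d (last x0 p) z = `|d x0 (last x0 p) - d x0 z|.
  move=> pq ->; rewrite (simple_path_dist_cat pq) distrC addrAC subrr add0r.
  by rewrite ger0_norm ?dist_ge0.
move=> up vp; move: spine_simple vp; case/splitPl: up => p1 p2 <- p12.
rewrite -cat_cons mem_cat => /orP[vp1|vp2].
  move: p12; case/splitPl: vp1 => q1 q2 <- /simple_path_cat[q12 _].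
  by rewrite distC distrC; apply: geod q12 _.
move: p12; case/path.splitP: vp2 => q1 q2.
rewrite catA => /simple_path_cat[p1q _].
by apply: geod p1q _; rewrite last_cat last_rcons.
Qed.

(** Off the spine, i has degree below 2, so every path from i passes through its only neighbour
    v. *)
Lemma parent_exists i : exists v,
  [/\ v \in x0 :: p0, i \in x0 :: p0 -> v = i &
      forall j, j != i -> d i j = d i v + d v j].
Proof.
have [ip|ip] := boolP (i \in x0 :: p0).
  by exists i; split=> // j _; rewrite distxx add0r.
have [k /andP[ki _]] := third_point n_ge3 i i.
have [[|v q] /andP[ivq Uivq] kE] := simple_path_exists i k.
  by rewrite -kE eqxx in ki.
have iv: e i v by case/andP: ivq.
have nbr u : e i u -> u = v.
  move=> iu; apply/eqP; apply: contraNT ip => uv; rewrite spineE.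
  by apply/card_gt1P; exists u, v; rewrite !inE.
exists v; split=> // [|j ji]; last first.
  have [[|u p] /= iup jE] := simple_path_exists i j.
    by rewrite -jE eqxx in ji.
  have uE: u = v by apply: nbr; case/andP: iup => /andP[].
  by subst u; have := @simple_path_dist_cat i [:: v] p iup; rewrite /= jE.
have vi: v != i by apply: contraTneq iv => ->; rewrite e_irr.
(* The path from i to a third point h gives v a second neighbour, so v is on the spine. *)
have [h /andP[hi hv]] := third_point n_ge3 i v.
have [[|u p] iup hE] := simple_path_exists i h; first by rewrite -hE eqxx in hi.
have uE: u = v by apply: nbr; case/andP: iup => /andP[].
subst u; case: p iup hE => [|u p] iup hE; first by rewrite -hE eqxx in hv.
rewrite spineE; case/andP: iup => /and3P[_ vu _]; rewrite /= !inE !negb_or.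
case/andP=> /and3P[_ iu _] _.
by apply/card_gt1P; exists i, u; rewrite !inE e_sym.
Qed.

Lemma caterpillar_linear_coords : exists s, linear_coords s t.
Proof.
have [P PE] := fin_all_exists parent_exists.
pose r i := d i (P i); pose s i := d x0 (P i).
have dP i j : j != i -> d i j = r i + d (P i) j by case: (PE i) => _ _; apply.
have PS i : P i \in x0 :: p0 by case: (PE i).
have Pid i : i \in x0 :: p0 -> P i = i by case: (PE i).
have dE i j : i != j -> d i j = `|s i - s j| + r i + r j.
  move=> ij; rewrite dP 1?eq_sym // -spine_dist //.
  have [<-|Pij] := eqVneq (P i) j.
    by rewrite /r !(Pid (P i)) // !distxx; lra.
  by rewrite distC dP // distC; lra.
have sr : linear_coords s r.
  split=> // [i|i]; first exact: dist_ge0.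
  by exists (P i); rewrite /r /s !(Pid (P i)) // distxx.
(* The lower bound [r i] is attained at two neighbours of i if i is on the spine, and otherwise at
   its parent and any third point. *)
have tr i : t i = r i.
  apply: t_val_eq => //; first exact: linear_tri sr i.
  have [iS|iS] := boolP (i \in x0 :: p0).
    have /card_gt1P[y [z]] : (2 <= degree e i)%N by rewrite -spineE.
    rewrite !inE => -[iy iz yz].
    have neq u : e i u -> i != u by apply: contraTneq => ->; rewrite e_irr.
    exists y, z; split; rewrite ?neq //.
    have yiz: simple_path e y [:: i; z].
      by rewrite /simple_path /= !inE negb_or e_sym iy iz yz !neq // eq_sym neq.
    have := @simple_path_dist_cat y [:: i] [:: z] yiz.
    rewrite /= /r Pid // distxx (distC y i); lra.
  have iP: i != P i by apply: contraNneq iS => ->.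
  have [z /andP[zi zP]] := third_point n_ge3 i (P i).
  exists (P i), z; split=> //; rewrite 1?eq_sym //.
  by rewrite (dP i z) // /r; lra.
exists s; case: sr => ? ? onto; split=> [i j ij|i|i]; rewrite ?tr ?dE //.
have [v [rv sv]] := onto i; by exists v; rewrite tr.
Qed.

End CaterpillarTree.

End Families.

Theorem theorem3p6 (R : realType) (n : nat) (hn : (3 <= n)%N)
    (D : {set 'I_n} -> R) (hD : positive_family D) (a b : 'I_n)
    (hab : dist D a b - t_val D a - t_val D b =
           seq_max [seq dist D p.1 p.2 - t_val D p.1 - t_val D p.2 |
                     p : 'I_n * 'I_n]) :
  caterpillarlike D <->
  [/\ four_point D,
      median_family D
    & forall i j : 'I_n, i \notin [:: a; b] -> j \notin [:: a; b] -> i != j ->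
        Num.max (dist D a i + dist D b j) (dist D a j + dist D b i)
          <= dist D a b + dist D i j].
Proof.
split=> [[e [w [cat_e _ wE]]]|[D4 Dmed Dab]].
  have [[e_sym e_irr e_conn _] [x0 [p0 [spine spineE]]]] := cat_e.
  have [s st] :=
    caterpillar_linear_coords hD hn e_sym e_irr e_conn spine spineE wE.
  have max_ab u v : dist D u v - t_val D u - t_val D v <=
      dist D a b - t_val D a - t_val D b.
    by rewrite hab; apply: seq_max_ge; apply/imageP; exists (u, v).
  split; [exact: linear_four_point st | exact: linear_median hD _ _ st |].
  move=> i j iab jab ij; rewrite ge_max (linear_maximal_pair st) //=.
  by rewrite (distC D i) (linear_maximal_pair st) // eq_sym.
have Dab' i j : i \notin [:: a; b] -> j \notin [:: a; b] -> i != j ->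
    dist D a i + dist D b j <= dist D a b + dist D i j.
  by move=> iab jab /(Dab i j iab jab); rewrite ge_max => /andP[].
move/four_pointP: D4 => D4.
have [ab|ab] := eqVneq a b.
  apply: (linear_caterpillarlike hD hn D4 Dmed).
  exact: (star_coords hD hn Dmed Dab' ab).
apply: (linear_caterpillarlike hD hn D4 Dmed).
exact: (segment_coords hD hn D4 Dmed Dab' ab).
Qed.
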